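(* Let $k\ge2$, $r\ge1$ and $n\ge1$ be integers such that $(n/k)^{1/r}$ is a positive integer. For $0\le i\le r$ put $m_i=(n/k)^{i/r}$ and define the words in $[k]^n$ $$w_i=\bigl(1^{m_i}2^{m_i}\cdots k^{m_i}\bigr)^{\frac{n}{k m_i}},\qquad \mathrm{rev}\,w_i=\bigl(k^{m_i}\cdots 2^{m_i}1^{m_i}\bigr)^{\frac{n}{k m_i}}.$$ Then the family of $r+k+2$ words $$\mathcal{W}=\{w_0,w_1,\ldots,w_r,\ \mathrm{rev}\,w_r,\ 1^n,2^n,\ldots,k^n\}$$ satisfies $$\mathrm{LCS}(\mathcal{W})\ \le\ \frac nk+k^{1/r}n^{1-1/r}.$$
   Context: $[k]=\{1,2,\ldots,k\}$ is a $k$-letter alphabet, and $[k]^n$ is the set of all words (finite sequences of symbols) of length $n$ over $[k]$. For a word $w$ (in particular for a single letter), $w^m$ denotes the concatenation of $m$ copies of $w$. A subsequence of a word $w$ is any word obtained from $w$ by deleting zero or more symbols (not necessarily consecutive ones). A common subsequence of $w$ and $w'$ is a word that is a subsequence of both; $\mathrm{LCS}(w,w')$ denotes the length of a longest common subsequence of $w$ and $w'$. For a family $\mathcal{W}$ of words, $\mathrm{LCS}(\mathcal{W})=\max\mathrm{LCS}(w,w')$, where the maximum is over all pairs of distinct members $w,w'$ of the listed family $\mathcal{W}$. *)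

(* Defs.v *)
From HB Require Import structures.
From mathcomp Require Import all_boot all_order all_algebra.
From mathcomp Require Import reals exp.

Set Implicit Arguments.
Unset Strict Implicit.
Unset Printing Implicit Defensive.

Import Order.TTheory GRing.Theory Num.Theory.

(* The alphabet [k] is 'I_k, the letter j being the ordinal j - 1; words are
   sequences over it, and subsequences are those of seq.v (not necessarily
   contiguous). *)

Definition word_pow (T : Type) (w : seq T) (m : nat) : seq T :=
  flatten (nseq m w).

(* The bound l <= size w loses nothing, as t is a subsequence of w. *)
Definition LCS (T : finType) (w w' : seq T) : nat :=
  \max_(l < (size w).+1 | [exists t : l.-tuple T, subseq t w && subseq t w']) l.

(* Members of the listed family are distinguished by their position, so a word
   listed twice forms a pair with itself. *)
Definition LCS_family (T : finType) (W : seq (seq T)) : nat :=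
  \max_(i < size W) \max_(j < size W | i != j) LCS (nth [::] W i) (nth [::] W j).

(* (n/k)^(i/r); the truncation is exact for every i when (n/k)^(1/r) is a
   natural number and r > 0. *)
Definition block_length (R : realType) (k r n i : nat) : nat :=
  Num.truncn ((n%:R / k%:R : R) `^ (i%:R / r%:R))%R.

(* The division n %/ (k * m) is exact for the block lengths m = (n/k)^(i/r),
   0 <= i <= r, with (n/k)^(1/r) an integer. *)
Definition block_word (k n m : nat) : seq 'I_k :=
  word_pow (flatten [seq word_pow [:: a] m | a <- enum 'I_k]) (n %/ (k * m)).

Definition rev_block_word (k n m : nat) : seq 'I_k :=
  word_pow (flatten [seq word_pow [:: a] m | a <- rev (enum 'I_k)])
    (n %/ (k * m)).

Definition word_family (R : realType) (k r n : nat) : seq (seq 'I_k) :=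
  [seq block_word k n (block_length R k r n i) | i <- iota 0 r.+1]
  ++ rev_block_word k n (block_length R k r n r)
  :: [seq word_pow [:: a] n | a <- enum 'I_k].

(* Main.v *)
Require Import Defs.
From HB Require Import structures.
From mathcomp Require Import all_boot all_order all_algebra.
From mathcomp Require Import reals exp.
From mathcomp Require Import zify ring.

Set Implicit Arguments.
Unset Strict Implicit.
Unset Printing Implicit Defensive.

Import Order.TTheory GRing.Theory Num.Theory.

(** Write [n = k q^r], so that the bound is [q^r + k q^(r-1)] and the block
    lengths are [m_i = q^i]. For [i < j], cut a common subsequence of [w_i] and
    [w_j] (or of [w_i] and [rev w_r], with [j = r]) along the [n / m_j] blocks
    of the second word. Every piece repeats one letter, and is matched in a
    factor of [w_i]; since [w_i] is balanced up to one period [k m_i], a factor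
    of length [L] contains at most [L / k + m_i] copies of a letter. The factors
    being disjoint, the total is at most [n / k + (n / m_j) m_i]. The words
    [w_r] and [rev w_r] are sorted in opposite orders, so that their common
    subsequences are constant, and constant words are handled by counting. *)

(** * Common subsequences and their lengths *)

Lemma LCS_leqP (T : finType) (w w' : seq T) (B : nat) :
  reflect (forall t, subseq t w -> subseq t w' -> size t <= B) (LCS w w' <= B).
Proof.
rewrite /LCS; apply: (iffP (bigop.bigmax_leqP _ _ _)) => [H t tw tw' |].
  have lt_w : size t < (size w).+1 by rewrite ltnS size_subseq.
  apply: (H (Ordinal lt_w)); apply/existsP; exists (in_tuple t).
  by rewrite /= tw.
move=> H l /existsP[t /andP[tw tw']].
by rewrite -(size_tuple t); apply: H.
Qed.

Lemma LCSC (T : finType) (w w' : seq T) : LCS w w' = LCS w' w.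
Proof.
apply/eqP; rewrite eqn_leq; apply/andP; split; apply/LCS_leqP => t tw tw';
  exact: (LCS_leqP _ _ _ (leqnn _)).
Qed.

(** [LCS] is symmetric, so the positions [i != j] reduce to those with [i < j], which [pairwise]
    tests. *)
Lemma LCS_family_leq (T : finType) (W : seq (seq T)) (B : nat) :
  pairwise (fun w w' => LCS w w' <= B) W -> LCS_family W <= B.
Proof.
move=> /(pairwiseP [::]) H; apply/bigop.bigmax_leqP => i _.
apply/bigop.bigmax_leqP => j.
by rewrite neq_ltn => /orP[ltij|ltji]; [|rewrite LCSC]; apply: H;
  rewrite // inE ltn_ord.
Qed.

Lemma LCS_nseq (T : finType) (w : seq T) (c : T) (n : nat) :
  LCS w (nseq n c) <= count_mem c w.
Proof.
apply/LCS_leqP => t tw tc.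
rewrite -(_ : count_mem c t = size t); first exact: leq_count_subseq.
apply/eqP; rewrite -all_count; apply/allP => x /(mem_subseq tc).
by rewrite mem_nseq => /andP[].
Qed.

(** * Cutting common subsequences along constant blocks *)

Lemma subseq_cat_split (T : eqType) (t w1 w2 : seq T) :
  subseq t (w1 ++ w2) ->
  exists t1 t2, [/\ t = t1 ++ t2, subseq t1 w1 & subseq t2 w2].
Proof.
case/subseqP=> m sm ->; exists (mask (take (size w1) m) w1).
exists (mask (drop (size w1) m) w2); split; try exact: mask_subseq.
by rewrite -mask_cat ?cat_take_drop // size_takel // sm size_cat leq_addr.
Qed.

(** Greedy matching: [w] is cut right after the leftmost embedding of [t1]. *)
Lemma cat_subseq_split (T : eqType) (t1 t2 w : seq T) :
  subseq (t1 ++ t2) w ->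
  exists w1 w2, [/\ w = w1 ++ w2, subseq t1 w1 & subseq t2 w2].
Proof.
elim: w t1 => [|x w IHw] [|y t1] H; try by exists [::], [::]; split.
- by exists [::], (x :: w).
- move: H => /=; have [->|nyx] := eqVneq y x.
    by case/IHw=> w1 [w2 [-> s1 s2]]; exists (x :: w1), w2; rewrite /= eqxx.
  case/(IHw (y :: t1)) => w1 [w2 [-> s1 s2]].
  by exists (x :: w1), w2; rewrite /= (negPf nyx).
Qed.

(* Each constant piece of the common subsequence is matched inside a factor of
   [w], and these factors are disjoint. *)
Lemma LCS_constant_blocks (T : finType) (k D : nat) (w : seq T)
    (bs : seq (seq T)) :
  (forall x y z c, w = x ++ y ++ z -> k * count_mem c y <= size y + D) ->
  all (@constant T) bs ->
  k * LCS w (flatten bs) <= size w + size bs * D.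
Proof.
move=> Hw cbs; have /LCS_leqP := leqnn (LCS w (flatten bs)).
suff H t : subseq t w -> subseq t (flatten bs) ->
    k * size t <= size w + size bs * D.
  have [->|k0 _] := posnP k; first by rewrite mul0n.
  (* Dividing by [k] isolates [LCS], so that the bound can be checked on each common subsequence
     [t]. *)
  rewrite mulnC -leq_divRL //; apply/LCS_leqP => t tw tb.
  by rewrite leq_divRL // mulnC; apply: H.
elim: bs w t Hw cbs => [|b bs IH] w t Hw /=.
  by move=> _ _; case: t => //=; rewrite muln0.
case/andP=> cb cbs tw /subseq_cat_split[t1 [t2 [Et t1b t2bs]]].
move: tw; rewrite {}Et => /cat_subseq_split[w1 [w2 [Ew t1w1 t2w2]]].
have H2 : k * size t2 <= size w2 + size bs * D.
  apply: IH => // x y z c Ew2; apply: (Hw (w1 ++ x) y z c).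
  by rewrite Ew Ew2 -!catA.
have H1 : k * size t1 <= size w1 + D.
  (* As [b] is constant, a nonempty [t1] is a power of its first letter [c], and [Hw] bounds the
     copies of [c] in the factor [w1]. *)
  case: t1 t1b t1w1 => [|c t1] t1b t1w1; first by rewrite muln0.
  apply: leq_trans (Hw [::] w1 w2 c Ew); rewrite leq_mul2l; apply/orP; right.
  rewrite -(_ : count_mem c (c :: t1) = size (c :: t1)).
    exact: leq_count_subseq.
  have [n [x Eb]] : exists n x, b = nseq n x.
    case: b cb t1b => [|x b] //= cb _; exists (size b).+1, x => /=.
    by congr (_ :: _); apply/all_pred1P.
  have tx y : y \in c :: t1 -> y = x.
    by move/(mem_subseq t1b); rewrite Eb mem_nseq => /andP[_ /eqP].
  apply/eqP; rewrite -all_count; apply/allP => y /tx ->.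
  by rewrite inE (tx c) ?mem_head.
by rewrite size_cat Ew size_cat mulnDr mulSn addnACA leq_add.
Qed.

(** * Letter counts in powers of blocks *)

Notation blocks s m := (flatten [seq word_pow [:: a] m | a <- s]).

Lemma word_pow1 (T : Type) (a : T) (m : nat) : word_pow [:: a] m = nseq m a.
Proof. by elim: m => //= m <-. Qed.

Lemma word_powS (T : Type) (u : seq T) (e : nat) :
  word_pow u e.+1 = u ++ word_pow u e.
Proof. by []. Qed.

Lemma count_word_pow (T : Type) (p : pred T) (u : seq T) (e : nat) :
  count p (word_pow u e) = e * count p u.
Proof. by elim: e => // e IH; rewrite word_powS count_cat IH. Qed.

Lemma size_word_pow (T : Type) (u : seq T) (e : nat) :
  size (word_pow u e) = e * size u.
Proof. by rewrite -!count_predT count_word_pow. Qed.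

Lemma size_blocks (T : Type) (s : seq T) (m : nat) :
  size (blocks s m) = size s * m.
Proof. by elim: s => //= a s IH; rewrite size_cat IH word_pow1 size_nseq. Qed.

(** The copies of [c] fill the [m] positions that follow the first [index c s * m]; truncated
    subtraction yields [0] for shorter prefixes. *)
Lemma count_take_blocks (T : eqType) (s : seq T) (m t : nat) (c : T) :
  uniq s -> c \in s ->
  count_mem c (take t (blocks s m)) = minn m (t - index c s * m).
Proof.
elim: s t => //= a s IH t /andP[nas us]; rewrite inE word_pow1.
have -> : take t (nseq m a ++ blocks s m) =
    nseq (minn t m) a ++ take (t - m) (blocks s m).
  rewrite take_cat size_nseq; case: ltnP => [ltm|//].
  have -> : t - m = 0 by lia.
  by rewrite take0 cats0 take_nseq // ltnW.
rewrite count_cat count_nseq /= eq_sym (eq_sym a).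
have [->|nca] /= := eqVneq c a; last first.
  by move=> cs; rewrite IH //; nia.
move=> _; rewrite (_ : count_mem a _ = 0) ?mul0n; first lia.
apply/count_memPn; apply: contra nas => /mem_take /flatten_mapP[x xs].
by rewrite word_pow1 mem_nseq => /andP[_ /eqP->].
Qed.

Lemma count_blocks (T : eqType) (s : seq T) (m : nat) (c : T) :
  uniq s -> c \in s -> count_mem c (blocks s m) = m.
Proof.
move=> us cs; rewrite -(take_size (blocks s m)) count_take_blocks //.
by move: cs; rewrite size_blocks -index_mem; nia.
Qed.

(* The discrepancy [size p - size s * count c p] over prefixes [p] stays in an
   interval of length [size s * m]. *)
Lemma count_take_block_power (T : eqType) (s : seq T) (m e t : nat) (c : T)
    (d := index c s * m) (p := take t (word_pow (blocks s m) e)) :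
  uniq s -> c \in s ->
  size p <= size s * count_mem c p + d <= size p + size s * m.
Proof.
move=> us cs; rewrite {}/p.
have ds : d + m <= size s * m by move: cs; rewrite /d -index_mem; nia.
elim: e t => [|e IH] t; first by rewrite /= muln0; lia.
rewrite word_powS take_cat; case: ltnP => [lt_t|le_t].
  rewrite count_take_blocks // size_take lt_t -/d.
  rewrite size_blocks in lt_t.
  have s0 : 0 < size s by move: cs; rewrite -index_mem; lia.
  (* The prefix ends before, inside or beyond the block of [c], with [0], [t - d] or [m] copies of
     [c]. *)
  have [?|?] := leqP t d; first by rewrite (_ : minn _ _ = 0); lia.
  have [?|?] := leqP (t - d) m.
    have : size s * (t - d) <= size s * m by rewrite leq_mul2l; lia.
    have : t - d <= size s * (t - d) by rewrite leq_pmull.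
    lia.
  lia.
(* A full period adds [size s * m] to each of the three terms. *)
have := IH (t - size (blocks s m)).
rewrite count_cat size_cat count_blocks // size_blocks mulnDr; lia.
Qed.

(** The upper bound for the prefix [x ++ y] and the lower bound for the prefix [x] carry the same
    offset, which cancels in their difference. *)
Lemma count_factor_block_power (T : eqType) (s : seq T) (m e : nat)
    (x y z : seq T) (c : T) :
  uniq s -> c \in s -> word_pow (blocks s m) e = x ++ y ++ z ->
  size s * count_mem c y <= size y + size s * m.
Proof.
move=> us cs E.
have := count_take_block_power m e (size x) us cs.
rewrite E take_size_cat //; move: E; rewrite catA => E.
have := count_take_block_power m e (size (x ++ y)) us cs.
rewrite E take_size_cat // size_cat count_cat mulnDr; lia.
Qed.

(** * Bounds for pairs of block words *)

Lemma LCS_block_powers (T : finType) (s s' : seq T) (m m' e e' : nat) :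
  uniq s -> (forall c, c \in s) ->
  size s * LCS (word_pow (blocks s m) e) (word_pow (blocks s' m') e')
    <= e * (size s * m) + e' * size s' * (size s * m).
Proof.
move=> us sT; pose bs := flatten (nseq e' [seq word_pow [:: a] m' | a <- s']).
have -> : word_pow (blocks s' m') e' = flatten bs.
  by rewrite /bs; elim: (e') => //= e1 IH; rewrite word_powS flatten_cat -IH.
have := @LCS_constant_blocks T (size s) (size s * m)
  (word_pow (blocks s m) e) bs.
rewrite size_word_pow size_blocks.
have -> : size bs = e' * size s'.
  by rewrite /bs; elim: (e') => //= e1 IH; rewrite size_cat size_map IH.
apply=> [x y z c|]; first exact: count_factor_block_power.
rewrite /bs; elim: (e') => //= e1 IH; rewrite all_cat IH andbT all_map.
by apply/allP => a _ /=; rewrite word_pow1 constant_nseq.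
Qed.

Lemma pairwise_blocks (T : Type) (r : rel T) (s : seq T) (m : nat) :
  reflexive r -> pairwise r s -> pairwise r (blocks s m).
Proof.
move=> rr; elim: s => //= a s IH /andP[ras /IH rs].
rewrite word_pow1 pairwise_cat rs andbT; apply/andP; split.
  elim: s ras {IH rs} => [|b s IH] /=; first by rewrite allrel0r.
  case/andP=> rab /IH H; rewrite word_pow1 allrel_catr H andbT.
  by rewrite /allrel all_nseq /= all_nseq rab !orbT.
by elim: (m) => //= n ->; rewrite all_nseq rr orbT.
Qed.

Lemma LCS_blocks_rev (T : finType) (r : rel T) (s : seq T) (m : nat) :
  reflexive r -> transitive r -> antisymmetric r -> pairwise r s -> uniq s ->
  LCS (blocks s m) (blocks (rev s) m) <= m.
Proof.
move=> rr rt ra rs us; apply/LCS_leqP => -[|c t] // tw tw'.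
have cs : c \in s.
  by move/mem_subseq: tw => /(_ c (mem_head _ _)) /flatten_mapP[x xs];
    rewrite word_pow1 mem_nseq => /andP[_ /eqP->].
have rt1 := subseq_pairwise tw (pairwise_blocks m rr rs).
(* Transitivity makes [pairwise] equivalent to [sorted], where reversing the word flips the
   relation. *)
have rs' : pairwise (fun x y => r y x) (rev s).
  have rt' : transitive (fun x y => r y x).
    by move=> y x z /= ryx rzy; apply: rt rzy ryx.
  by rewrite -(sorted_pairwise rt') rev_sorted (sorted_pairwise rt).
have rt2 := subseq_pairwise tw'
  (pairwise_blocks m (r := fun x y => r y x) rr rs').
rewrite -[leqRHS](count_blocks m us cs).
rewrite -(_ : count_mem c (c :: t) = size (c :: t)).
  exact: leq_count_subseq.
move: rt1 rt2 => /= /andP[/allP r1 _] /andP[/allP r2 _].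
apply/eqP; rewrite eqxx add1n eqSS -all_count; apply/allP => x xt /=.
by apply/eqP; apply: ra; rewrite r1 // r2.
Qed.

Lemma LCS_short_long_blocks (k r q : nat) (s : seq 'I_k) (i j : nat) :
  0 < k -> 0 < q ->
  size s = k -> i < j <= r ->
  LCS (word_pow (blocks (enum 'I_k) (q ^ i)) (q ^ (r - i)))
      (word_pow (blocks s (q ^ j)) (q ^ (r - j))) <= q ^ r + k * q ^ r.-1.
Proof.
move=> k_gt0 q_gt0 ss /andP[ltij lejr].
have := @LCS_block_powers _ (enum 'I_k) s (q ^ i) (q ^ j) (q ^ (r - i))
  (q ^ (r - j)) (enum_uniq _) (mem_enum _).
rewrite size_enum_ord ss => H.
rewrite -(leq_pmul2l k_gt0); apply: leq_trans H _.
rewrite mulnDr leq_add //; first by rewrite mulnCA -expnD subnK //; lia.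
(* The powers of [q] combine to the exponent [r - j + i], at most [r.-1] because [i < j]. *)
rewrite (mulnC _ k) -mulnA (mulnCA _ k) -expnD !leq_pmul2l //.
by rewrite leq_pexp2l //; lia.
Qed.

Lemma block_wordE (k r q i : nat) :
  0 < k -> 0 < q -> i <= r ->
  block_word k (k * q ^ r) (q ^ i) =
    word_pow (blocks (enum 'I_k) (q ^ i)) (q ^ (r - i)).
Proof.
by move=> k_gt0 q_gt0 leir; rewrite /block_word divnMl // -expnB.
Qed.

Lemma rev_block_wordE (k r q : nat) :
  0 < k -> 0 < q ->
  rev_block_word k (k * q ^ r) (q ^ r) = blocks (rev (enum 'I_k)) (q ^ r).
Proof.
move=> k_gt0 q_gt0; rewrite /rev_block_word divnn muln_gt0 k_gt0 expn_gt0 q_gt0.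
exact: cats0.
Qed.

(** * The whole family *)

Lemma LCS_family_blocks (k r q : nat) :
  0 < k -> 0 < q ->
  LCS_family ([seq block_word k (k * q ^ r) (q ^ i) | i <- iota 0 r.+1]
      ++ rev_block_word k (k * q ^ r) (q ^ r)
      :: [seq word_pow [:: a] (k * q ^ r) | a <- enum 'I_k])
    <= q ^ r + k * q ^ r.-1.
Proof.
move=> k_gt0 q_gt0.
have le_iota i : i \in iota 0 r.+1 -> i <= r by rewrite mem_iota.
have count_word i c : i <= r ->
    count_mem c (block_word k (k * q ^ r) (q ^ i)) = q ^ r.
  move=> leir; rewrite block_wordE // count_word_pow.
  by rewrite count_blocks ?enum_uniq ?mem_enum // -expnD subnK.
have count_rev c : count_mem c (rev_block_word k (k * q ^ r) (q ^ r)) = q ^ r.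
  rewrite rev_block_wordE // count_blocks ?rev_uniq ?enum_uniq //.
  by rewrite mem_rev mem_enum.
apply: LCS_family_leq; rewrite pairwise_cat.
rewrite [pairwise _ (rev_block_word _ _ _ :: _)]pairwise_cons.
(* Four kinds of pairs: a block word with the reversed or a constant word, two block words, the
   reversed word with a constant one, two constant words. *)
apply/and4P; split.
- rewrite allrel_mapl; apply/allrelP => i w /le_iota leir.
  rewrite inE => /predU1P[->|/mapP[c _ ->]]; last first.
    rewrite word_pow1; apply: leq_trans (LCS_nseq _ _ _) _.
    by rewrite count_word // leq_addr.
  (* For [i = r] the bound on factors does not apply, and the opposite sorting of the two words, by
     letter value, is used instead. *)
  have [->|neir] := eqVneq i r.
    rewrite block_wordE // rev_block_wordE // subnn /word_pow /= cats0.
    apply: leq_trans (leq_addr _ _).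
    apply: (@LCS_blocks_rev _ (relpre val leq)); rewrite ?enum_uniq //.
    + by move=> x /=.
    + by move=> y x z /=; apply: leq_trans.
    + by move=> x y /= /anti_leq /val_inj.
    + rewrite -pairwise_map val_enum_ord -(sorted_pairwise leq_trans).
      exact: iota_sorted.
  rewrite block_wordE // rev_block_wordE //.
  have := @LCS_short_long_blocks k r q (rev (enum 'I_k)) i r k_gt0 q_gt0.
  rewrite subnn /word_pow /= cats0; apply.
    by rewrite size_rev size_enum_ord.
  by rewrite leqnn andbT ltn_neqAle neir.
- rewrite pairwise_map.
  have lt_pw : pairwise ltn (iota 0 r.+1).
    by rewrite -(sorted_pairwise ltn_trans) iota_ltn_sorted.
  apply: (sub_in_pairwise (P := fun i => i <= r) _ _ lt_pw); last exact/allP.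
  move=> i j leir lejr ltij /=.
  rewrite !block_wordE //.
  by apply: LCS_short_long_blocks => //; [exact: size_enum_ord | exact/andP].
- apply/allP => w /mapP[c _ ->].
  rewrite word_pow1; apply: leq_trans (LCS_nseq _ _ _) _.
  by rewrite count_rev leq_addr.
- rewrite pairwise_map.
  have := enum_uniq 'I_k; rewrite uniq_pairwise.
  apply: sub_pairwise => a b /= ab.
  rewrite !word_pow1; apply: leq_trans (LCS_nseq _ _ _) _.
  by rewrite count_nseq /= (negPf ab).
Qed.

(** * From real powers to powers of [q] *)

Local Open Scope ring_scope.

Theorem mainTheorem4 (R : realType) (k r n : nat)
  (hk : (2 <= k)%N) (hr : (1 <= r)%N) (hn : (1 <= n)%N)
  (hnk : exists q : nat,
      (0 < q)%N /\ (n%:R / k%:R : R) `^ (1 / r%:R) = q%:R) :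
  (LCS_family (word_family R k r n))%:R
    <= n%:R / k%:R + k%:R `^ (1 / r%:R) * n%:R `^ (1 - 1 / r%:R) :> R.
Proof.
case: hnk => q [q_gt0 hq].
have k_gt0 : (0 < k)%N by lia.
have k0 : k%:R != 0 :> R by rewrite pnatr_eq0; lia.
have r0 : r%:R != 0 :> R by rewrite pnatr_eq0; lia.
have n0 : n%:R != 0 :> R by rewrite pnatr_eq0; lia.
have nk0 : 0 <= n%:R / k%:R :> R by rewrite divr_ge0.
(* The power is [((n / k) ^ (1 / r)) ^ i]; the case [i = r] then gives [n = k * q ^ r]. *)
have powE i : (n%:R / k%:R : R) `^ (i%:R / r%:R) = (q ^ i)%:R.
  by rewrite (mulrC i%:R) -[r%:R^-1]mul1r powRrM hq powR_mulrn // natrX.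
have nkE : n%:R / k%:R = (q ^ r)%:R :> R by rewrite -powE divff // powRr1.
have En : n = (k * q ^ r)%N.
  by apply/eqP; rewrite -(eqr_nat R) natrM -nkE mulrC divfK.
have lenE i : block_length R k r n i = (q ^ i)%N.
  by rewrite /block_length powE natrK.
(* Since [n ^ (1 / r) = q * k ^ (1 / r)], the factor [k ^ (1 / r)] cancels and leaves [n / q]. *)
have boundE : k%:R `^ (1 / r%:R) * n%:R `^ (1 - 1 / r%:R) =
    (k * q ^ r.-1)%:R :> R.
  have q0 : q%:R != 0 :> R by rewrite pnatr_eq0; lia.
  rewrite powRB ?n0 ?implybT // powRr1 //.
  have -> : n%:R `^ (1 / r%:R) = q%:R * k%:R `^ (1 / r%:R) :> R.
    by rewrite -hq -powRM // divfK.
  have kr0 : k%:R `^ (1 / r%:R) != 0 :> R by rewrite powR_eq0 negb_and k0.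
  move: (k%:R `^ (1 / r%:R)) kr0 => c c0.
  rewrite {1}En -(prednK hr) /= expnS !natrM; field.
  by rewrite c0.
rewrite nkE boundE -natrD ler_nat /word_family lenE.
rewrite (eq_map (g := fun i => block_word k n (q ^ i))); last first.
  by move=> i; rewrite lenE.
rewrite {}En; by apply: LCS_family_blocks.
Qed.
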